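(* Let $P$ be a pre-meadow, let $0\cdot P=\{0\cdot x\mid x\in P\}$, and for $z\in 0\cdot P$ let $P_z:=\{x\in P\mid 0\cdot x=z\}$. Then $P$ is the disjoint union $P=\bigsqcup_{z\in 0\cdot P}P_z$, and for every $z\in 0\cdot P$ the set $P_z$, with the operations of $P$ restricted to it, is either a unital commutative ring or a copy of the zero ring, with zero element $z$ and unit $1+z$.
   Context: A pre-meadow is a set $P$ with constants $0,1$, binary operations $+,\cdot$ and a unary operation $-$ such that for all $x,y,z\in P$: $(x+y)+z=x+(y+z)$; $x+y=y+x$; $x+0=x$; $x+(-x)=0\cdot x$; $(x\cdot y)\cdot z=x\cdot(y\cdot z)$; $x\cdot y=y\cdot x$; $1\cdot x=x$; $x\cdot(y+z)=x\cdot y+x\cdot z$; $-(-x)=x$; $0\cdot(x+y)=0\cdot x\cdot y$. A unital commutative ring is a commutative ring with identity different from zero; the zero ring is the ring with exactly one element. *)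

(* Defs.v *)
From HB Require Import structures.
From mathcomp Require Import all_boot all_algebra.
From mathcomp Require Import boolp classical_sets.

Set Implicit Arguments.
Unset Strict Implicit.
Unset Printing Implicit Defensive.

Import GRing.Theory.

Declare Scope premeadow_scope.
Delimit Scope premeadow_scope with pm.

HB.mixin Record isPreMeadow (P : Type) := {
  pm0 : P;
  pm1 : P;
  pmadd : P -> P -> P;
  pmmul : P -> P -> P;
  pmopp : P -> P;
  pmaddA : forall x y z, pmadd (pmadd x y) z = pmadd x (pmadd y z);
  pmaddC : forall x y, pmadd x y = pmadd y x;
  pmaddr0 : forall x, pmadd x pm0 = x;
  pmaddrN : forall x, pmadd x (pmopp x) = pmmul pm0 x;
  pmmulA : forall x y z, pmmul (pmmul x y) z = pmmul x (pmmul y z);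
  pmmulC : forall x y, pmmul x y = pmmul y x;
  pmmul1r : forall x, pmmul pm1 x = x;
  pmmulDr : forall x y z, pmmul x (pmadd y z) = pmadd (pmmul x y) (pmmul x z);
  pmoppK : forall x, pmopp (pmopp x) = x;
  pmmul0D : forall x y, pmmul pm0 (pmadd x y) = pmmul (pmmul pm0 x) y
}.

#[short(type="preMeadowType")]
HB.structure Definition PreMeadow := { P of isPreMeadow P }.

Notation "0" := pm0 : premeadow_scope.
Notation "1" := pm1 : premeadow_scope.
Notation "x + y" := (pmadd x y) : premeadow_scope.
Notation "x * y" := (pmmul x y) : premeadow_scope.
Notation "- x" := (pmopp x) : premeadow_scope.

Definition zero_mul (P : preMeadowType) : set P :=
  [set (0 * x)%pm | x in [set: P]]%classic.

Arguments zero_mul P : clear implicits.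

Definition fiber (P : preMeadowType) (z : P) : set P :=
  [set x | (0 * x)%pm = z]%classic.

(* When [f] is the inclusion of a subset [R] of [P], this says that the ring
   operations of [R] are those of [P] restricted to [R] (so that [R] is closed
   under them), with zero element [z] and unit [e]. *)
Definition ring_ops_from (P : preMeadowType) (z e : P)
    (R : comPzRingType) (f : R -> P) : Prop :=
  [/\ forall x y : R, f (x + y)%R = (f x + f y)%pm,
      forall x y : R, f (x * y)%R = (f x * f y)%pm,
      forall x : R, f (- x)%R = (- f x)%pm,
      f 0%R = z
    & f 1%R = e].

(* [GRing.ComNzRing S] and [GRing.ComPzRing S] are the types of structures of
   commutative ring with identity on the carrier [S] itself, with [1 <> 0]
   required for the former only. *)
Definition is_unital_comring_in (P : preMeadowType) (S : set P) (z e : P) :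
    Prop :=
  exists c : GRing.ComNzRing S,
    @ring_ops_from P z e (GRing.ComNzRing.Pack c) (fun x : S => val x).

Definition is_zero_ring_in (P : preMeadowType) (S : set P) (z e : P) : Prop :=
  exists c : GRing.ComPzRing S,
    @ring_ops_from P z e (GRing.ComPzRing.Pack c) (fun x : S => val x)
    /\ exists x : S, forall y : S, y = x.

(* Main.v *)
From HB Require Import structures.
Require Import Defs.
From mathcomp Require Import all_boot all_algebra.
From mathcomp Require Import boolp classical_sets.

(** The map [x |-> 0 * x] is idempotent, and on each of its fibres both [x + y]
    and [x * y] have the same image as [x]; for [- x] this follows from
    computing [x + - x = - x + - - x] in two ways. On the fibre over [z] the
    element [z] is neutral for [+] and absorbing for [*], so the fibre is a
    commutative ring with unit [1 + z], which is trivial exactly when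
    [1 + z = z]. *)

Set Implicit Arguments.
Unset Strict Implicit.
Unset Printing Implicit Defensive.

Section PreMeadowTheory.
Variable P : preMeadowType.
Implicit Types x y z : P.
Local Open Scope premeadow_scope.

Lemma pmadd0r x : 0 + x = x.
Proof. by rewrite pmaddC pmaddr0. Qed.

Lemma pmmulr1 x : x * 1 = x.
Proof. by rewrite pmmulC pmmul1r. Qed.

Lemma pmmulDl x y z : (y + z) * x = y * x + z * x.
Proof. by rewrite pmmulC pmmulDr !(pmmulC x). Qed.

(** The axiom [0 * (x + y) = 0 * x * y] at [y = 0]. *)
Lemma pmmul0K x : 0 * (0 * x) = 0 * x.
Proof. by rewrite pmmulC -pmmul0D pmaddr0. Qed.

Lemma pmaddr_mul0 x : x + 0 * x = x.
Proof. by rewrite -{1}(pmmul1r x) -pmmulDl pmaddr0 pmmul1r. Qed.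

(** Both sides equal [0 * (x + y)], one by the last axiom and the other by distributivity. *)
Lemma pmmul0M x y : 0 * (x * y) = 0 * x + 0 * y.
Proof. by rewrite -pmmulA -pmmul0D pmmulDr. Qed.

(** The left side is [0 * x + 0 * x], and [0 * x] is its own image under multiplication by [0], so
    adding it to itself changes nothing. *)
Lemma pmmul0_absorbing x : 0 * x * x = 0 * x.
Proof. by rewrite pmmulA pmmul0M -{2}pmmul0K pmaddr_mul0. Qed.

Lemma pmmul0N x : 0 * - x = 0 * x.
Proof. by rewrite -!pmaddrN pmoppK pmaddC. Qed.

Lemma zero_mul_fixed z : zero_mul P z -> 0 * z = z.
Proof. by case=> x _ <-; rewrite pmmul0K. Qed.

End PreMeadowTheory.

(** The proof [z_fixed] is kept as a parameter of the type so that instance inference can recover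
    it: the ring structure depends on it. *)
Definition fiber_type (P : preMeadowType) (z : P)
  (z_fixed : (0 * z)%pm = z) : Type := fiber z.

Section FiberRing.
Variables (P : preMeadowType) (z : P) (z_fixed : (0 * z)%pm = z).
Local Open Scope premeadow_scope.
Local Notation F := (fiber_type z_fixed).
Implicit Types x y : F.

Let fiberE x : 0 * val x = z.
Proof. exact: set_valP x. Qed.

(** Silently closes the goals left in [add_in] and [mul_in]. *)
Let addzz : z + z = z.
Proof. by rewrite -{2}z_fixed pmaddr_mul0. Qed.

Let fiber_mk (a : P) (az : 0 * a = z) : F := SigSub (mem_set az).

Let one_in : 0 * (1 + z) = z.
Proof. by rewrite pmmulDr pmmulr1 pmadd0r. Qed.

Let add_in x y : 0 * (val x + val y) = z.
Proof. by rewrite pmmulDr !fiberE. Qed.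

Let mul_in x y : 0 * (val x * val y) = z.
Proof. by rewrite pmmul0M !fiberE. Qed.

Let opp_in x : 0 * - val x = z.
Proof. by rewrite pmmul0N fiberE. Qed.

Definition fiber_zero : F := fiber_mk z_fixed.
Definition fiber_one : F := fiber_mk one_in.
Definition fiber_add x y : F := fiber_mk (add_in x y).
Definition fiber_mul x y : F := fiber_mk (mul_in x y).
Definition fiber_opp x : F := fiber_mk (opp_in x).

Lemma fiber_addA : associative fiber_add.
Proof. by move=> x y t; apply: val_inj; rewrite /= pmaddA. Qed.

Lemma fiber_addC : commutative fiber_add.
Proof. by move=> x y; apply: val_inj; rewrite /= pmaddC. Qed.

Lemma fiber_add0 : left_id fiber_zero fiber_add.
Proof.
move=> x; apply: val_inj; rewrite /= pmaddC.
by have := pmaddr_mul0 (val x); rewrite fiberE.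
Qed.

Lemma fiber_addN : left_inverse fiber_zero fiber_opp fiber_add.
Proof. by move=> x; apply: val_inj; rewrite /= pmaddC pmaddrN fiberE. Qed.

Lemma fiber_mulA : associative fiber_mul.
Proof. by move=> x y t; apply: val_inj; rewrite /= pmmulA. Qed.

Lemma fiber_mulC : commutative fiber_mul.
Proof. by move=> x y; apply: val_inj; rewrite /= pmmulC. Qed.

Lemma fiber_mul0 : left_zero fiber_zero fiber_mul.
Proof.
move=> x; apply: val_inj => /=.
by have := pmmul0_absorbing (val x); rewrite fiberE.
Qed.

(** Since [1] lies over [0], it is shifted by [z] into the fibre; then
    [(1 + z) * x = x + z * x = x + z = x]. *)
Lemma fiber_mul1 : left_id fiber_one fiber_mul.
Proof.
move=> x; apply: val_inj => /=; rewrite pmmulDl pmmul1r.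
have -> : z * val x = z := congr1 val (fiber_mul0 x).
by rewrite pmaddC; exact: (congr1 val (fiber_add0 x)).
Qed.

Lemma fiber_mulDl : left_distributive fiber_mul fiber_add.
Proof. by move=> x y t; apply: val_inj; rewrite /= pmmulDl. Qed.

HB.instance Definition _ := gen_eqMixin F.
HB.instance Definition _ := gen_choiceMixin F.
HB.instance Definition _ :=
  GRing.isZmodule.Build F fiber_addA fiber_addC fiber_add0 fiber_addN.
HB.instance Definition _ := GRing.Zmodule_isComPzRing.Build F
  fiber_mulA fiber_mulC fiber_mul1 fiber_mulDl.

Lemma fiber_unital_comring :
  1 + z <> z -> is_unital_comring_in (fiber z) z (1 + z).
Proof.
move=> one_neq0.
have nz : (1%R : F) != 0%R by apply/eqP => /(congr1 val).
(* Nontriviality depends on [one_neq0], so this structure is packed locally instead of being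
   declared as an instance. *)
pose nzF := GRing.PzSemiRing_isNonZero.Build F nz.
pose R : comNzRingType := HB.pack F nzF.
by exists (GRing.ComNzRing.class R); split.
Qed.

Lemma fiber_zero_ring : 1 + z = z -> is_zero_ring_in (fiber z) z (1 + z).
Proof.
move=> one_eq0; exists (GRing.ComPzRing.class F); split; first by split.
exists fiber_zero => x.
have one0 : fiber_one = fiber_zero by apply: val_inj.
by rewrite -[x]fiber_mul1 one0 fiber_mul0.
Qed.

End FiberRing.

Theorem theorem2p5 (P : preMeadowType) :
  (\bigcup_(z in zero_mul P) fiber z = [set: P])%classic
  /\ trivIset (zero_mul P) (@fiber P)
  /\ (forall z : P, zero_mul P z ->
        is_unital_comring_in (fiber z) z (1 + z)%pm
        \/ is_zero_ring_in (fiber z) z (1 + z)%pm).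
Proof.
split; first by apply/seteqP; split=> // x _; exists (0 * x)%pm => //; exists x.
(* A common point [x] of two fibres forces both indices to be [0 * x]. *)
split; first by move=> z t _ _ [x [<- <-]].
move=> z /zero_mul_fixed z_fixed.
(* Excluded middle is used, as equality in [P] need not be decidable. *)
have [one_eq0|one_neq0] := pselect ((1 + z)%pm = z).
  by right; apply: fiber_zero_ring.
by left; apply: fiber_unital_comring.
Qed.
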